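(* In the bilateral trade environment, if a social choice function $f=(q,x)$ is individually rational and ex-post efficient, then $f$ is not fully implementable in any solution concept $\mathcal{S}$ satisfying Weak Solution Consistency (WSC).
   Context: Bilateral trade environment. There are two agents, $I=\{B,S\}$ (buyer and seller), and an indivisible object. Agent $i$'s type is her valuation $t_i\in T_i=[a_i,b_i]$, distributed according to $p_i$, which admits a continuous and strictly positive density on $[a_i,b_i]$; $t_B$ and $t_S$ are independent, each agent knows her own valuation and the distribution of the other's, and $(a_S,b_S)\cap(a_B,b_B)\neq\emptyset$. So the belief of type $t_i$ over the other agent's type, $p_i(\cdot|t_i)$, is the distribution of the other's valuation. $T=T_B\times T_S$. Alternatives are pairs $(q,x)$, $q\in[0,1]$ the probability of trade and $x\in\mathbb{R}$ the amount transferred from buyer to seller. Agents are risk neutral with utilities $u_B((q,x),t)=q\,t_B-x$ and $u_S((q,x),t)=x-q\,t_S$. A social choice function (SCF) is here a measurable $f=(q,x):T\to[0,1]\times\mathbb{R}$. $f$ is ex-post efficient if $q(t)=1$ whenever $t_B>t_S$ and $q(t)=0$ whenever $t_B<t_S$. $f$ is individually rational if $u_i(f(t),t)\geq0$ for all $i\in I$ and $t\in T$. General framework. A mechanism is $\gamma=(\mu,S)$ with $S=\times_iS_i$ (each $S_i$ a separable metrizable space) and $\mu:S\to\Delta(A)$ measurable, where $A$ is the set of alternatives; $\Gamma$ is the class of all mechanisms. For a lottery $a\in\Delta(A)$, $u_i(a,t)$ denotes expected utility (expected utilities are understood to be well defined). Given $\gamma$, $\Sigma$ is the set of measurable $\sigma:T\to\Delta(S)$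 and $\Sigma_{-i}$ the set of measurable $T_{-i}\to\Delta(S_{-i})$; $\mu(\sigma)$ is the map sending $t$ to the lottery $\mu(\sigma(t))$ induced by $\sigma(t)$. An expectation profile for $\gamma$ is $e=(e_i)_{i\in I}$ with $e_i:T_i\to\Sigma_{-i}$. A theory of expectations $E$ assigns to each $\gamma$ a set $E(\gamma)$ of expectation profiles; a theory of response $R$ assigns to each $\gamma$ and $e\in E(\gamma)$ a set $R(e)\subseteq\Sigma$. A solution concept is $\mathcal{S}=(R,E)$, with $\mathcal{S}(\gamma)=\bigcup_{e\in E(\gamma)}R(e)$. $f$ is fully implementable in $\mathcal{S}$ if there is a mechanism $\gamma=(\mu,S)$ with $\{\mu(\sigma):\sigma\in\mathcal{S}(\gamma)\}=\{f\}$ (identifying an alternative with the degenerate lottery on it) and $R(e)\neq\emptyset$ for all $e\in E(\gamma)$. WSC. $\mathcal{S}$ satisfies WSC if for all $\gamma\in\Gamma$ with $\mathcal{S}(\gamma)\neq\emptyset$, all $i\in I$ and $t_i\in T_i$ there exists $\sigma\in\mathcal{S}(\gamma)$ such that for all $t_i'\in T_i$: $\int_{T_{-i}}u_i(\mu(\sigma(t)),t)\,dp_i(t_{-i}|t_i)\geq\int_{T_{-i}}u_i(\mu(\sigma(t_i',t_{-i})),t)\,dp_i(t_{-i}|t_i)$, where $t=(t_i,t_{-i})$. *)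

(* Defs.v *)
From HB Require Import structures.
From mathcomp Require Import all_boot all_order all_algebra.
From mathcomp Require Import all_classical all_reals all_analysis.

Set Implicit Arguments.
Unset Strict Implicit.
Unset Printing Implicit Defensive.

Import Order.TTheory GRing.Theory Num.Theory.
Import numFieldNormedType.Exports.

Local Open Scope classical_set_scope.
Local Open Scope ring_scope.

(* The closed interval [a, b] as a type, with the sigma-algebra induced by the
   Borel sets of R. The proof of a <= b makes it inhabited, as required by
   [measurableType]. *)
Record segment (R : realType) (a b : R) (ab : a <= b) : Type := Segment {
  segment_val : R;
  segment_prop : segment_val \in `[a, b] }.

HB.instance Definition _ (R : realType) (a b : R) (ab : a <= b) :=
  [isSub for @segment_val R a b ab].
HB.instance Definition _ (R : realType) (a b : R) (ab : a <= b) :=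
  [Choice of segment ab by <:].

Lemma segment_left (R : realType) (a b : R) (ab : a <= b) : a \in `[a, b].
Proof. by rewrite in_itv/= lexx. Qed.

HB.instance Definition _ (R : realType) (a b : R) (ab : a <= b) :=
  isPointed.Build (segment ab) (Segment ab (segment_left ab)).
HB.instance Definition _ (R : realType) (a b : R) (ab : a <= b) :=
  Measurable.copy (segment ab)
    (g_sigma_algebra_preimageType (@segment_val R a b ab)).

Definition has_continuous_positive_density (R : realType) (a b : R)
    (ab : a <= b) (p : probability (segment ab) R) : Prop :=
  exists g : R -> R,
    [/\ {within `[a, b], continuous g},
        forall x, x \in `[a, b] -> 0 < g x &
        forall U : set R, measurable U ->
          p (@segment_val R a b ab @^-1` U) =
          (\int[lebesgue_measure]_(x in `[a, b] `&` U) (g x)%:E)%E].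

Definition separable (X : topologicalType) : Prop :=
  exists2 D : set X, countable D & dense D.

Definition metrizable (R : realType) (X : topologicalType) : Prop :=
  exists dist : X -> X -> R,
    [/\ forall x y, dist x y = 0 <-> x = y,
        forall x y, dist x y = dist y x,
        forall x y z, dist x z <= dist x y + dist y z &
        forall x (U : set X),
          nbhs x U <-> exists2 e, 0 < e & [set y | dist x y < e] `<=` U].

Notation Borel X := (g_sigma_algebraType (@open X)).

Section framework.
Context {R : realType} {dB dS dA : measure_display}.
Context (TB : measurableType dB) (TS : measurableType dS).
Context (A : measurableType dA).

(* For separable metrizable factors the product sigma-algebra used below is the
   Borel sigma-algebra of the product space. A measurable map into a space of
   lotteries is a probability kernel. *)
Record mechanism := Mechanism {
  stratB : ptopologicalType;
  stratS : ptopologicalType;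
  stratB_separable : separable stratB;
  stratB_metrizable : metrizable R stratB;
  stratS_separable : separable stratS;
  stratS_metrizable : metrizable R stratS;
  outcome : R.-pker (Borel stratB * Borel stratS) ~> A }.

Definition strategy_profile (gamma : mechanism) : Type :=
  R.-pker (TB * TS) ~> (Borel (stratB gamma) * Borel (stratS gamma))%type.

(* No measurability is required in an agent's own type. *)
Definition expectation_profile (gamma : mechanism) : Type :=
  ((TB -> R.-pker TS ~> Borel (stratS gamma)) *
   (TS -> R.-pker TB ~> Borel (stratB gamma)))%type.

Definition theory_of_expectations : Type :=
  forall gamma : mechanism, set (expectation_profile gamma).

Definition theory_of_response (E : theory_of_expectations) : Type :=
  forall (gamma : mechanism) (e : expectation_profile gamma),
    E gamma e -> set (strategy_profile gamma).

Record solution_concept := SolutionConcept {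
  expectations : theory_of_expectations;
  response : theory_of_response expectations }.

Definition solutions (S : solution_concept) (gamma : mechanism) :
    set (strategy_profile gamma) :=
  [set sigma | exists (e : expectation_profile gamma)
    (Ee : expectations S e), response Ee sigma].
Arguments solutions : clear implicits.

(* The lottery over alternatives obtained at t: draw a message profile from
   sigma t, then an alternative from the outcome of the mechanism. *)
Definition induced (gamma : mechanism) (sigma : strategy_profile gamma) :
    TB * TS -> {measure set A -> \bar R} :=
  mkcomp_noparam sigma (outcome gamma).

(* In the library a measure assigns an irrelevant value to each nonmeasurable
   set; restricting to measurable sets makes equality of lotteries the intended
   one. *)
Definition lottery (m : {measure set A -> \bar R}) :
    {U : set A | measurable U} -> \bar R := fun U => m (sval U).

Definition fully_implementable (S : solution_concept) (f : TB * TS -> A) :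
    Prop :=
  exists gamma : mechanism,
    [set (fun t => lottery (induced sigma t)) | sigma in solutions S gamma] =
      [set (fun t => lottery (dirac (f t)))] /\
    forall (e : expectation_profile gamma) (Ee : expectations S e),
      response Ee !=set0.

Section WSC.
Context (uB uS : A -> TB * TS -> R).
Context (beliefB : TB -> probability TS R) (beliefS : TS -> probability TB R).

Definition expected_utility (u : A -> TB * TS -> R)
    (m : {measure set A -> \bar R}) (t : TB * TS) : \bar R :=
  (\int[m]_a (u a t)%:E)%E.

(* [interimB sigma tB tB'] is the expected utility of buyer type tB when she
   behaves as type tB' would under sigma; similarly [interimS] for the seller. *)
Definition interimB (gamma : mechanism) (sigma : strategy_profile gamma)
    (tB tB' : TB) : \bar R :=
  (\int[beliefB tB]_tS expected_utility uB (induced sigma (tB', tS)) (tB, tS))%E.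

Definition interimS (gamma : mechanism) (sigma : strategy_profile gamma)
    (tS tS' : TS) : \bar R :=
  (\int[beliefS tS]_tB expected_utility uS (induced sigma (tB, tS')) (tB, tS))%E.

(* All integrals in [interimB] and [interimS] exist and are finite. *)
Definition utilities_well_defined (gamma : mechanism)
    (sigma : strategy_profile gamma) : Prop :=
  [/\ forall tB tB' tS, (induced sigma (tB', tS)).-integrable setT
        (fun a => (uB a (tB, tS))%:E),
      forall tB tB', (beliefB tB).-integrable setT
        (fun tS => expected_utility uB (induced sigma (tB', tS)) (tB, tS)),
      forall tS tS' tB, (induced sigma (tB, tS')).-integrable setT
        (fun a => (uS a (tB, tS))%:E) &
      forall tS tS', (beliefS tS).-integrable setT
        (fun tB => expected_utility uS (induced sigma (tB, tS')) (tB, tS))].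

(* The convention that expected utilities are well defined appears as the
   second premise, so the default value of a divergent Lebesgue integral
   never enters a comparison. *)
Definition WSC (S : solution_concept) : Prop :=
  forall gamma : mechanism,
    solutions S gamma !=set0 ->
    (forall sigma, solutions S gamma sigma -> utilities_well_defined sigma) ->
    (forall tB : TB, exists2 sigma, solutions S gamma sigma &
       forall tB' : TB, (interimB sigma tB tB' <= interimB sigma tB tB)%E) /\
    (forall tS : TS, exists2 sigma, solutions S gamma sigma &
       forall tS' : TS, (interimS sigma tS tS' <= interimS sigma tS tS)%E).

End WSC.

End framework.

Arguments solutions {R dB dS dA TB TS A} S gamma _.

(* (q, x): probability of trade and transfer from buyer to seller. *)
Notation alternative R := (segment (@ler01 R) * R)%type.

Section bilateral_trade.
Context {R : realType} {aB bB aS bS : R} {aBbB : aB <= bB} {aSbS : aS <= bS}.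
Local Notation TB := (segment aBbB).
Local Notation TS := (segment aSbS).

Definition utilB (a : alternative R) (t : TB * TS) : R :=
  let: (q, x) := a in segment_val q * segment_val t.1 - x.

Definition utilS (a : alternative R) (t : TB * TS) : R :=
  let: (q, x) := a in x - segment_val q * segment_val t.2.

Definition individually_rational (f : TB * TS -> alternative R) : Prop :=
  forall t, 0 <= utilB (f t) t /\ 0 <= utilS (f t) t.

Definition ex_post_efficient (f : TB * TS -> alternative R) : Prop :=
  forall t,
    (segment_val t.2 < segment_val t.1 -> segment_val (f t).1 = 1) /\
    (segment_val t.1 < segment_val t.2 -> segment_val (f t).1 = 0).

End bilateral_trade.

(* Main.v *)
(* Full implementation forces every solution of the mechanism to induce f, so
   WSC makes f Bayesian incentive compatible, and the argument is that of
   Myerson and Satterthwaite. Incentive compatibility and individual rationality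
   give buyer tB at least the interim utility E[max 0 (tB - max tS aB)], and
   seller tS at least E[max 0 (min tB bS - tS)]. If tB > tS, then
     (tB - max tS aB) + (min tB bS - tS) =
       (tB - tS) + (min tB bS - max tS aB),
   where the last term is nonnegative, and bounded away from 0 on a product of
   two intervals of positive probability. The two agents thus expect together
   more than the gains from trade max 0 (tB - tS), which is all that there is to
   share since the transfers cancel. *)

Require Import Defs.
From HB Require Import structures.
From mathcomp Require Import all_boot all_order all_algebra.
From mathcomp Require Import all_classical all_reals all_analysis.
From mathcomp Require Import measurable_realfun.
From mathcomp Require Import ring lra.

Import Order.TTheory GRing.Theory Num.Theory.
Import numFieldNormedType.Exports.

Local Open Scope classical_set_scope.
Local Open Scope ring_scope.

(** * Growth from a bound on increments *)

(* Cut [a, b] into n equal pieces: the errors telescope to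
   (b - a) / n * (G a - G b). *)
Lemma increment_bound_le (R : realType) (a b : R) (D G : R -> R) :
  (forall v w, a <= v -> v <= w -> w <= b ->
    (w - v) * (G v - G w) <= D w - D v) ->
  a <= b -> D a <= D b.
Proof.
move=> incr ab; rewrite -subr_ge0 leNgt; apply/negP => Dneg.
have step n : (0 < n)%N ->
    (b - a) / n%:R * (G a - G b) <= D b - D a.
  move=> n0.
  pose r i := a + (b - a) / n%:R * i%:R.
  have n0' : 0 < n%:R :> R by rewrite ltr0n.
  have h0 : 0 <= (b - a) / n%:R by rewrite divr_ge0 ?subr_ge0 // ltW.
  have r0 : r 0%N = a by rewrite /r mulr0 addr0.
  have rn : r n = b by rewrite /r divfK ?gt_eqF // addrC subrK.
  have rS i : r i.+1 = r i + (b - a) / n%:R by rewrite /r -natr1; ring.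
  suff H i : (i <= n)%N ->
      (b - a) / n%:R * (G a - G (r i)) <= D (r i) - D a.
    by move: (H n (leqnn n)); rewrite rn.
  elim: i => [_|i IH lin]; first by rewrite r0 !subrr mulr0.
  have {}IH := IH (ltnW lin).
  have ri : r i <= r i.+1 by rewrite rS lerDl.
  have ai : a <= r i by rewrite /r lerDl mulr_ge0.
  have ib : r i.+1 <= b by rewrite -rn /r lerD2l ler_wpM2l // ler_nat.
  move: (incr _ _ ai ri ib); rewrite rS addrAC subrr add0r -rS => incri.
  nra.
(* If [G a - G b] is nonnegative, a single piece already contradicts [Dneg]. Otherwise n is taken so
   large that the total error [C / n] falls below the supposed drop [D a - D b]. *)
have [K0|K0] := leP 0 (G a - G b).
  have := step 1%N isT; rewrite divr1 => S.
  by have : 0 <= (b - a) * (G a - G b); [rewrite mulr_ge0 // subr_ge0|lra].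
have C0 : 0 <= (b - a) * (G b - G a) by apply: mulr_ge0; lra.
have e0 : 0 < - (D b - D a) by lra.
set C := _ * _ in C0.
pose n := (Num.trunc (C / - (D b - D a))).+1.
have nC : C / - (D b - D a) < n%:R by exact: truncnS_gt.
have n0 : 0 < n%:R :> R by rewrite ltr0n.
have := step n isT.
have -> : (b - a) / n%:R * (G a - G b) = - (C / n%:R) by rewrite /C; ring.
rewrite lerNl ler_pdivlMr // mulrC; move: nC; rewrite ltr_pdivrMr //; lra.
Qed.

(** * Measures and integrals on an interval of types *)

Lemma measurable_segment_val (R : realType) (a b : R) (ab : a <= b) :
  measurable_fun setT (@segment_val R a b ab).
Proof. by move=> _ U mU; rewrite setTI; exists U => //; rewrite setTI. Qed.

(** If the integral vanished, the density would be zero almost everywhere on [c, d]; being positive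
    there, it would make [c, d] a null set, against its length d - c > 0. *)
Lemma density_gt0 (R : realType) (a b : R) (ab : a <= b)
    (p : probability (segment ab) R) (c d : R) :
  has_continuous_positive_density p -> a <= c -> c < d -> d <= b ->
  (0 < p (@segment_val R a b ab @^-1` `[c, d]))%E.
Proof.
move=> [g [gc g0 gE]] ac cd db.
have cdab : `[c, d] `<=` `[a, b].
  by apply: subset_itv; rewrite bnd_simp.
rewrite gE // setIidr // lt_neqAle integral_ge0 ?andbT; last first.
  by move=> x xcd; rewrite lee_fin ltW// g0//; exact: cdab.
apply/eqP => /esym int0.
have mg : measurable_fun `[c, d] g.
  apply: subspace_continuous_measurable_fun => //.
  exact: continuous_subspaceW gc.
have mEg : measurable_fun `[c, d] (EFin \o g) by exact/measurable_EFinP.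
have abs0 : (\int[lebesgue_measure]_(x in `[c, d]) `|(EFin \o g) x| = 0)%E.
  rewrite -[RHS]int0; apply: eq_integral => x; rewrite inE => xcd.
  by rewrite gee0_abs// lee_fin ltW// g0//; exact: cdab.
have /(ae_eq_integral_abs lebesgue_measure) := abs0.
move=> /(_ _ mEg)[//|N [mN N0 sub]].
have cdN : `[c, d] `<=` N.
  move=> x xcd; apply: sub => /(_ xcd)/= [gx0].
  by have := g0 x (cdab _ xcd); rewrite gx0 ltxx.
have : (lebesgue_measure (`[c, d] : set R) <= 0 :> \bar R)%E.
  by rewrite -N0; apply: le_measure => //; rewrite inE.
by rewrite lebesgue_measure_itv/= lte_fin cd leNgt lte_fin subr_gt0 cd.
Qed.

Lemma integrable_subr {d} {Y : measurableType d} {R : realType}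
    {p : probability Y R} {g h : Y -> R} :
  p.-integrable setT (EFin \o g) -> p.-integrable setT (EFin \o h) ->
  p.-integrable setT (EFin \o (fun y => g y - h y)).
Proof. by move=> ig ih; exact: (integrableB _ ig ih). Qed.

Lemma integrable_mulr d (Y : measurableType d) (R : realType)
    (p : probability Y R) (g : Y -> R) (k : R) :
  p.-integrable setT (EFin \o g) ->
  p.-integrable setT (EFin \o (fun y => g y * k)).
Proof. by move=> ig; exact: (integrableZr measurableT k ig). Qed.

Lemma bounded_integrable d (Y : measurableType d) (R : realType)
    (p : probability Y R) (g : Y -> R) (K : R) :
  measurable_fun setT g -> (forall y, `|g y| <= K) ->
  p.-integrable setT (EFin \o g).
Proof.
move=> mg gK; apply: measurable_bounded_integrable => //.
  exact: le_lt_trans (probability_le1 p measurableT) (ltry 1).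
exists K; split; first exact: num_real.
by move=> M KM y _; exact: le_trans (gK y) (ltW KM).
Qed.

(** * Information rent of one agent *)

(** The positive part of v - c has slope at most 1 in v, and it vanishes up to c, hence up to w when
    w <= m. *)
Lemma max0B_increment (R : realType) (u w m c : R) : u <= w -> m <= c ->
  Num.max 0 (w - c) - Num.max 0 (u - c) <= (w - u) * (m < w)%R%:R.
Proof.
move=> uw mc; have V0 : 0 <= Num.max 0 (u - c) by rewrite le_max lexx.
have V1 : u - c <= Num.max 0 (u - c) by rewrite le_max lexx orbT.
by case: (ltP m w) => mw /=; rewrite lerBlDr ge_max; apply/andP; split; lra.
Qed.

(* Efficiency and incentive compatibility make v's interim utility grow at least
   as fast as the function E[max 0 (v - max m a)], whose slope is the
   probability that m < v, the interim probability of trade. *)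
Lemma information_rent d (Y : measurableType d) (R : realType)
    (p : probability Y R) (a b : R) (q x : R -> Y -> R) (m : Y -> R) :
  measurable_fun setT m ->
  (forall v, a <= v <= b -> p.-integrable setT (EFin \o q v)) ->
  (forall v, a <= v <= b -> p.-integrable setT (EFin \o x v)) ->
  (forall v y, a <= v <= b -> 0 <= q v y) ->
  (forall v y, a <= v <= b -> m y < v -> 1 <= q v y) ->
  (forall y, 0 <= q a y * a - x a y) ->
  (forall v w, a <= v <= b -> a <= w <= b ->
    \int[p]_y (q w y * v - x w y) <= \int[p]_y (q v y * v - x v y)) ->
  forall v, a <= v <= b ->
  0 <= \int[p]_y (q v y * v - x v y - Num.max 0 (v - Num.max (m y) a)).
Proof.
move=> mm iq ix q0 q1 ir ic v /andP[av vb].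
pose V w y := Num.max 0 (w - Num.max (m y) a).
pose J w := [set y | m y < w].
have mJ w : measurable (J w).
  have := measurable_fun_ltr mm (measurable_cst w).
  by move=> /(_ measurableT [set true] I); rewrite setTI.
have iJ w : p.-integrable setT (EFin \o (fun y => \1_(J w) y)).
  exact: integrable_indic.
have iV w : p.-integrable setT (EFin \o V w).
  apply: (@bounded_integrable _ _ _ _ _ `|w - a|).
    apply: measurable_maxr => //; apply: measurable_funB => //.
    exact: measurable_maxr.
  move=> y; rewrite /V ger0_norm ?le_max ?lexx // ge_max normr_ge0 /=.
  by apply: le_trans (ler_norm _); rewrite lerD2l lerN2 le_max lexx orbT.
have iU w u : a <= w <= b ->
    p.-integrable setT (EFin \o (fun y => q w y * u - x w y)).
  by move=> wab; apply: integrable_subr (ix _ wab); exact/integrable_mulr/iq.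
(* [D] is the quantity to be shown nonnegative, and [G w] is the probability that m < w. At the
   lowest type [V] is zero, so individual rationality gives [Da]; [increment_bound_le] carries the
   sign up to v. *)
pose D w := \int[p]_y (q w y * w - x w y - V w y).
pose G w := \int[p]_y (\1_(J w) y : R).
have Da : 0 <= D a.
  apply: Rintegral_ge0 => y _; apply: addr_ge0 => //.
  by rewrite /V oppr_ge0 ge_max lexx subr_le0 le_max lexx orbT.
apply: (le_trans Da); apply: (@increment_bound_le _ a v D G) => // {Da}.
move=> u w au uw wv.
have uab : a <= u <= b by lra.
have wab : a <= w <= b by lra.
have DE z : a <= z <= b ->
    D z = \int[p]_y (q z y * z - x z y) - \int[p]_y V z y.
  by move=> zab; rewrite /D RintegralB //; exact: iU.
rewrite !DE //.
(* Type w may imitate u, so [D w] only decreases when the outcome of w is replaced by that of u,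
   still valued at w. The payments then cancel in the difference. *)
apply: (@le_trans _ _ (\int[p]_y (q u y * w - x u y) - \int[p]_y V w y -
   (\int[p]_y (q u y * u - x u y) - \int[p]_y V u y))); last first.
  by rewrite 2!lerD2r ic.
rewrite -(RintegralB _ (iU u w uab) (iV w)) //.
rewrite -(RintegralB _ (iU u u uab) (iV u)) //.
rewrite -(RintegralB _ (integrable_subr (iU u w uab) (iV w))
  (integrable_subr (iU u u uab) (iV u))) //.
rewrite -(RintegralB _ (iJ u) (iJ w)) //.
rewrite -RintegralZl //; last exact: integrable_subr.
apply: le_Rintegral => //.
- under eq_fun do rewrite mulrC.
  exact/integrable_mulr/integrable_subr.
- by do 2 apply: integrable_subr; do ?[exact: iU|exact: iV].
(* Pointwise, the value of the outcome of u grows by [q u y * (w - u)], at least w - u where m < u,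
   while [V] grows by at most w - u where m < w and not at all elsewhere. *)
move=> y _; rewrite !indicE /V.
have JE z : (y \in J z) = (m y < z) by apply/idP/idP; rewrite inE.
rewrite !JE; have wu0 : 0 <= w - u by rewrite subr_ge0.
have quw : 0 <= q u y * (w - u) by rewrite mulr_ge0 // q0.
have quw1 : m y < u -> w - u <= q u y * (w - u).
  by move=> myu; rewrite ler_peMl // q1.
have := @max0B_increment _ u w (m y) (Num.max (m y) a) uw.
rewrite le_max lexx => /(_ isT) incr.
suff : (w - u) * (m y < u)%R%:R <= q u y * (w - u) by lra.
by move: quw1; case: (ltP (m y) u) => [_ /(_ isT)|_ _] /=; lra.
Qed.

(** * Expectations over both types *)

Lemma Rintegral_prod_ge0_l d1 d2 (X : measurableType d1) (Y : measurableType d2)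
    (R : realType) (p : probability X R) (r : probability Y R)
    (h : X * Y -> R) :
  (p \x r)%E.-integrable setT (EFin \o h) ->
  (forall x, r.-integrable setT (EFin \o (fun y => h (x, y)))) ->
  (forall x, 0 <= \int[r]_y h (x, y)) ->
  0 <= \int[(p \x r)%E]_t h t.
Proof.
move=> ih ihx h0; apply: fine_ge0; rewrite -(integral12_prod_meas1 ih).
apply: integral_ge0 => x _; rewrite /fubini_F -[leRHS]fineK ?lee_fin //.
  exact: h0.
exact: integrable_fin_num (ihx x).
Qed.

Lemma Rintegral_prod_ge0_r d1 d2 (X : measurableType d1) (Y : measurableType d2)
    (R : realType) (p : probability X R) (r : probability Y R)
    (h : X * Y -> R) :
  (p \x r)%E.-integrable setT (EFin \o h) ->
  (forall y, p.-integrable setT (EFin \o (fun x => h (x, y)))) ->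
  (forall y, 0 <= \int[p]_x h (x, y)) ->
  0 <= \int[(p \x r)%E]_t h t.
Proof.
move=> ih ihy h0; apply: fine_ge0; rewrite -(integral21_prod_meas1 ih).
apply: integral_ge0 => y _; rewrite /fubini_G -[leRHS]fineK ?lee_fin //.
  exact: h0.
exact: integrable_fin_num (ihy y).
Qed.

(** By Fubini, taken in one order for g and in the other for h, both have nonnegative integral over
    the product. The proposed upper bound has integral -e times the probability of the rectangle,
    which is negative. *)
Lemma nonneg_sections_sum_not_lt0 d1 d2 (X : measurableType d1)
    (Y : measurableType d2) (R : realType) (p : probability X R)
    (r : probability Y R) (g h : X * Y -> R) (K e : R) (A : set X) (B : set Y) :
  measurable_fun setT g -> measurable_fun setT h ->
  (forall t, `|g t| <= K) -> (forall t, `|h t| <= K) ->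
  (forall x, 0 <= \int[r]_y g (x, y)) ->
  (forall y, 0 <= \int[p]_x h (x, y)) ->
  measurable A -> measurable B -> (0 < p A)%E -> (0 < r B)%E -> 0 < e ->
  ~ (forall t, g t + h t <= \1_(A `*` B) t * - e).
Proof.
move=> mg mh gK hK g0 h0 mA mB pA rB e0 gh.
pose P : probability (X * Y)%type R := (p \x r)%E.
have ig : P.-integrable setT (EFin \o g) by exact: bounded_integrable gK.
have ih : P.-integrable setT (EFin \o h) by exact: bounded_integrable hK.
have Ig : 0 <= \int[P]_t g t.
  apply: Rintegral_prod_ge0_l => // x.
  by apply: (@bounded_integrable _ _ _ _ _ K) => //; exact: measurableT_comp.
have Ih : 0 <= \int[P]_t h t.
  apply: Rintegral_prod_ge0_r => // y.
  by apply: (@bounded_integrable _ _ _ _ _ K) => //; exact: measurableT_comp.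
have mAB : measurable (A `*` B) by exact: measurableX.
have iAB : P.-integrable setT (EFin \o (fun t => \1_(A `*` B) t)).
  exact: integrable_indic.
have : \int[P]_t (g t + h t) <= \int[P]_t (\1_(A `*` B) t * - e).
  apply: le_Rintegral => //; first exact: (integrableD _ ig ih).
  exact: integrable_mulr.
rewrite RintegralD // RintegralZr //.
have PE : P (A `*` B) = (p A * r B)%E by exact: product_measure1E.
have P0 : (0 < P (A `*` B))%E by rewrite PE mule_gt0.
have : 0 < fine (P (A `*` B)) * e.
  by rewrite mulr_gt0 // fine_gt0 // P0 ltey_eq fin_num_measure.
have -> : \int[P]_t (\1_(A `*` B) t : R) = fine (P (A `*` B)).
  by rewrite /Rintegral integral_indic // setIT.
lra.
Qed.

(** Without the truncations at 0 the right side exceeds tB - tS by min tB b - max tS a, which is the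
    least of the four differences bounded below by e. *)
Lemma rents_exceed_surplus (R : realType) (tB tS a b e : R) :
  e <= tB - tS -> e <= tB - a -> e <= b - tS -> e <= b - a ->
  tB - tS + e <= Num.max 0 (tB - Num.max tS a) +
                 Num.max 0 (- tS - Num.max (- tB) (- b)).
Proof.
move=> e1 e2 e3 e4.
apply: (@le_trans _ _ (tB - Num.max tS a + (- tS - Num.max (- tB) (- b)))).
  by case: (ltP tS a); case: (ltP (- tB) (- b)) => *; lra.
by apply: lerD; rewrite le_max lexx orbT.
Qed.

(** Turns the real-valued types of [information_rent] into elements of the segment; a real outside
    [a, b] goes to the default a. *)
Definition clip {R : realType} {a b : R} (ab : a <= b) (v : R) : segment ab :=
  insubd (Segment ab (segment_left ab)) v.

Lemma clipK (R : realType) (a b : R) (ab : a <= b) (v : R) :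
  a <= v <= b -> segment_val (clip ab v) = v.
Proof. by move=> vab; apply: insubdK; rewrite unfold_in /= in_itv. Qed.

Lemma segment_valK (R : realType) (a b : R) (ab : a <= b) :
  cancel (@segment_val R a b ab) (clip ab).
Proof. by move=> t; apply: val_inj; apply: insubdK; exact: segment_prop. Qed.

Lemma segment_val_bounds {R : realType} {a b : R} {ab : a <= b}
  (t : segment ab) : a <= segment_val t <= b.
Proof. by have := segment_prop t; rewrite in_itv. Qed.

(** * Bounds and integrability in the trade environment *)

Section bilateral_trade.
Context {R : realType} {aB bB aS bS : R} {aBbB : aB <= bB} {aSbS : aS <= bS}.
Local Notation TB := (segment aBbB).
Local Notation TS := (segment aSbS).

Lemma utilBE (a : alternative R) (t : TB * TS) :
  utilB a t = segment_val a.1 * segment_val t.1 - a.2.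
Proof. by case: a. Qed.

Lemma utilSE (a : alternative R) (t : TB * TS) :
  utilS a t = a.2 - segment_val a.1 * segment_val t.2.
Proof. by case: a. Qed.

Lemma measurable_utilB (t : TB * TS) :
  measurable_fun setT (fun a : alternative R => utilB a t).
Proof.
under eq_fun do rewrite utilBE.
apply: measurable_funB => //; apply: measurable_funM => //.
by apply: measurableT_comp => //; exact: measurable_segment_val.
Qed.

Lemma measurable_utilS (t : TB * TS) :
  measurable_fun setT (fun a : alternative R => utilS a t).
Proof.
under eq_fun do rewrite utilSE.
apply: measurable_funB => //; apply: measurable_funM => //.
by apply: measurableT_comp => //; exact: measurable_segment_val.
Qed.

Variables (pB : probability TB R) (pS : probability TS R).
Variable f : TB * TS -> alternative R.
Hypothesis f_measurable : measurable_fun setT f.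
Hypothesis f_ir : individually_rational f.
Hypothesis f_efficient : ex_post_efficient f.

Let q t := segment_val (f t).1.
Let x t := (f t).2.

Let q01 t : 0 <= q t <= 1. Proof. exact: segment_val_bounds. Qed.

Let mq : measurable_fun setT q.
Proof.
apply: measurableT_comp; first exact: measurable_segment_val.
exact: measurableT_comp.
Qed.

Let mx : measurable_fun setT x.
Proof. exact: measurableT_comp. Qed.

Let M := `|aB| + `|bB| + `|aS| + `|bS|.

Let types_bounded (t : TB * TS) :
  `|segment_val t.1| <= M /\ `|segment_val t.2| <= M.
Proof.
have /andP[] := segment_val_bounds t.1; have /andP[] := segment_val_bounds t.2.
have := ler_norm aB; have := ler_norm (- aB); rewrite normrN.
have := ler_norm bB; have := ler_norm (- bB); rewrite normrN.
have := ler_norm aS; have := ler_norm (- aS); rewrite normrN.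
have := ler_norm bS; have := ler_norm (- bS); rewrite normrN /M.
have := normr_ge0 aB; have := normr_ge0 bB.
have := normr_ge0 aS; have := normr_ge0 bS.
by rewrite !ler_norml => *; split; apply/andP; split; lra.
Qed.

Let trade_values_bounded t :
  q t * segment_val t.1 <= M /\ - M <= q t * segment_val t.2.
Proof.
have /andP[q0 q1] := q01 t; have [] := types_bounded t.
rewrite !ler_norml => /andP[_ B1] /andP[S0 _].
have M0 : 0 <= M by rewrite /M !addr_ge0.
have qM : q t * M <= M by rewrite ler_piMl.
have := ler_wpM2l q0 B1; have := ler_wpM2l q0 S0; rewrite mulrN; lra.
Qed.

(** Individual rationality squeezes the transfer between q times the seller's cost and q times the
    buyer's valuation, and both lie within M of 0. *)
Let utilities_bounded t :
  [/\ `|x t| <= M, 0 <= utilB (f t) t <= 2 * M & 0 <= utilS (f t) t <= 2 * M].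
Proof.
have [uB uS] := f_ir t; have [] := trade_values_bounded t.
move: uB uS; rewrite utilBE utilSE -/(q t) -/(x t) ler_norml.
by move=> *; split; apply/andP; split; lra.
Qed.

Let integrable_q {d} {Y : measurableType d} (p : probability Y R)
    {g : Y -> TB * TS} :
  measurable_fun setT g -> p.-integrable setT (EFin \o (q \o g)).
Proof.
move=> mg; apply: (@bounded_integrable _ _ _ _ _ 1).
  exact: measurableT_comp.
by move=> y /=; have /andP[q0 q1] := q01 (g y); rewrite ger0_norm.
Qed.

Let integrable_x {d} {Y : measurableType d} (p : probability Y R)
    {g : Y -> TB * TS} :
  measurable_fun setT g -> p.-integrable setT (EFin \o (x \o g)).
Proof.
move=> mg; apply: (@bounded_integrable _ _ _ _ _ M).
  exact: measurableT_comp.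
by move=> y /=; have [] := utilities_bounded (g y).
Qed.

Lemma integrable_utilB (tB tB' : TB) :
  pS.-integrable setT (EFin \o (fun tS => utilB (f (tB', tS)) (tB, tS))).
Proof.
under eq_fun do rewrite utilBE.
apply: integrable_subr; last exact: (integrable_x _ (pair1_measurable tB')).
apply: integrable_mulr; exact: (integrable_q _ (pair1_measurable tB')).
Qed.

Lemma integrable_utilS (tS tS' : TS) :
  pB.-integrable setT (EFin \o (fun tB => utilS (f (tB, tS')) (tB, tS))).
Proof.
under eq_fun do rewrite utilSE.
apply: integrable_subr; first exact: (integrable_x _ (pair2_measurable tS')).
apply: integrable_mulr; exact: (integrable_q _ (pair2_measurable tS')).
Qed.

(** * Incentive compatible efficient trade *)

Hypothesis pB_density : has_continuous_positive_density pB.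
Hypothesis pS_density : has_continuous_positive_density pS.
Hypothesis overlap : (`]aS, bS[ : set R) `&` `]aB, bB[ !=set0.

Hypothesis icB : forall tB tB' : TB,
  \int[pS]_tS utilB (f (tB', tS)) (tB, tS) <=
  \int[pS]_tS utilB (f (tB, tS)) (tB, tS).
Hypothesis icS : forall tS tS' : TS,
  \int[pB]_tB utilS (f (tB, tS')) (tB, tS) <=
  \int[pB]_tB utilS (f (tB, tS)) (tB, tS).

(* The utility of each agent minus her payoff in the Vickrey-Clarke-Groves
   mechanism in which her worst type gets nothing. *)
Let excessB t := utilB (f t) t -
  Num.max 0 (segment_val t.1 - Num.max (segment_val t.2) aB).
Let excessS t := utilS (f t) t -
  Num.max 0 (- segment_val t.2 - Num.max (- segment_val t.1) (- bS)).

Lemma buyer_excess_ge0 tB : 0 <= \int[pS]_tS excessB (tB, tS).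
Proof.
pose Q v tS := q (clip aBbB v, tS).
pose X v tS := x (clip aBbB v, tS).
have eqU v w : aB <= v <= bB -> \int[pS]_y (Q w y * v - X w y) =
    \int[pS]_tS utilB (f (clip aBbB w, tS)) (clip aBbB v, tS).
  by move=> vab; apply: eq_Rintegral => tS _; rewrite utilBE /= clipK.
have -> : \int[pS]_tS excessB (tB, tS) = \int[pS]_tS
    (Q (segment_val tB) tS * segment_val tB - X (segment_val tB) tS -
     Num.max 0 (segment_val tB - Num.max (segment_val tS) aB)).
  by apply: eq_Rintegral => tS _; rewrite /excessB utilBE /Q /X segment_valK.
apply: (@information_rent _ _ _ pS aB bB Q X).
- exact: measurable_segment_val.
- by move=> v _; exact: (integrable_q _ (pair1_measurable _)).
- by move=> v _; exact: (integrable_x _ (pair1_measurable _)).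
- by move=> v y _; have /andP[] := q01 (clip aBbB v, y).
- move=> v y vab yv; rewrite /Q /q.
  by have [-> //] := f_efficient (clip aBbB v, y); rewrite /= clipK.
- move=> y; have [+ _] := f_ir (clip aBbB aB, y).
  by rewrite utilBE /= clipK // lexx.
- by move=> v w vab wab; rewrite !eqU.
exact: segment_val_bounds.
Qed.

(* The seller is a buyer whose valuation is the opposite of her cost. *)
Lemma seller_excess_ge0 tS : 0 <= \int[pB]_tB excessS (tB, tS).
Proof.
(* Here v is minus the cost and the payment is minus the price received, so the worst type v = -bS
   is the seller with the highest cost. *)
pose Q v tB := q (tB, clip aSbS (- v)).
pose X v tB := - x (tB, clip aSbS (- v)).
have opp v : - bS <= v <= - aS -> aS <= - v <= bS.
  by rewrite lerNl lerNr andbC.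
have eqU v w : - bS <= v <= - aS -> \int[pB]_y (Q w y * v - X w y) =
    \int[pB]_tB utilS (f (tB, clip aSbS (- w))) (tB, clip aSbS (- v)).
  move=> /opp vab; apply: eq_Rintegral => tB _.
  by rewrite utilSE /= clipK // mulrN !opprK addrC.
have -> : \int[pB]_tB excessS (tB, tS) = \int[pB]_tB
    (Q (- segment_val tS) tB * - segment_val tS - X (- segment_val tS) tB -
     Num.max 0 (- segment_val tS - Num.max (- segment_val tB) (- bS))).
  apply: eq_Rintegral => tB _; rewrite /excessS utilSE /Q /X opprK segment_valK.
  by rewrite mulrN opprK [_ + x _]addrC.
apply: (@information_rent _ _ _ pB (- bS) (- aS) Q X).
- by apply: measurableT_comp => //; exact: measurable_segment_val.
- by move=> v _; exact: (integrable_q _ (pair2_measurable _)).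
- move=> v _.
  exact: (integrableN (integrable_x pB (pair2_measurable _))).
- by move=> v y _; have /andP[] := q01 (y, clip aSbS (- v)).
- move=> v y /opp vab yv; rewrite /Q /q.
  have [-> //] := f_efficient (y, clip aSbS (- v)).
  by rewrite /= clipK // ltrNl.
- move=> y; have [_ +] := f_ir (y, clip aSbS (- - bS)).
  by rewrite utilSE /Q /X mulrN !opprK /q /x /= clipK ?lexx ?andbT // addrC.
- by move=> v w vab wab; rewrite !eqU.
by rewrite !lerN2 andbC segment_val_bounds.
Qed.

Let mexcessB : measurable_fun setT excessB.
Proof.
have mv1 : measurable_fun setT (fun t : TB * TS => segment_val t.1).
  by apply: measurableT_comp => //; exact: measurable_segment_val.
have mv2 : measurable_fun setT (fun t : TB * TS => segment_val t.2).
  by apply: measurableT_comp => //; exact: measurable_segment_val.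
apply: measurable_funB.
  under eq_fun do rewrite utilBE.
  by apply: measurable_funB => //; exact: measurable_funM.
apply: measurable_maxr => //; apply: measurable_funB => //.
exact: measurable_maxr.
Qed.

Let mexcessS : measurable_fun setT excessS.
Proof.
have mv1 : measurable_fun setT (fun t : TB * TS => - segment_val t.1).
  do 2 apply: measurableT_comp => //; exact: measurable_segment_val.
have mv2 : measurable_fun setT (fun t : TB * TS => segment_val t.2).
  by apply: measurableT_comp => //; exact: measurable_segment_val.
apply: measurable_funB.
  under eq_fun do rewrite utilSE.
  by apply: measurable_funB => //; exact: measurable_funM.
apply: measurable_maxr => //; apply: measurable_funB => //.
  exact: measurableT_comp.
exact: measurable_maxr.
Qed.

(** Each excess has nonnegative interim expectation, yet their sum is nowhere positive and is at
    most -e on a rectangle of types of positive probability. *)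
Lemma no_incentive_compatible_efficient_trade : False.
Proof.
have [z [/=]] := overlap; rewrite !in_itv /= => /andP[aSz zbS] /andP[aBz zbB].
(* The overlap starts at l, and w is the midpoint of l and z. Buyers in [z, bB] and sellers in
   [aS, w] keep all four differences of [rents_exceed_surplus] at least e = z - w. *)
pose l := Num.max aS aB; pose w := (l + z) / 2.
have lz : l < z by rewrite /l gt_max aSz.
have aSl : aS <= l by rewrite le_max lexx.
have aBl : aB <= l by rewrite le_max lexx orbT.
pose e := (z - l) / 2; have e0 : 0 < e by rewrite /e; lra.
apply: (@nonneg_sections_sum_not_lt0 _ _ _ _ _ pB pS excessB excessS (2 * M) e
  (@segment_val R aB bB aBbB @^-1` `[z, bB])
  (@segment_val R aS bS aSbS @^-1` `[aS, w])) => //.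
- move=> t; have [] := types_bounded t.
  have [_ /andP[? ?] _] := utilities_bounded t.
  rewrite /excessB !ler_norml /Num.max => /andP[? ?] /andP[? ?].
  by case: (ltP (segment_val t.2) aB) => ?; case: ltP => ?;
    apply/andP; split; lra.
- move=> t; have [] := types_bounded t.
  have [_ _ /andP[? ?]] := utilities_bounded t.
  rewrite /excessS !ler_norml /Num.max => /andP[? ?] /andP[? ?].
  by case: (ltP _ (- bS)) => ?; case: ltP => ?; apply/andP; split; lra.
- exact: buyer_excess_ge0.
- exact: seller_excess_ge0.
- by rewrite -[X in measurable X]setTI; exact: measurable_segment_val.
- by rewrite -[X in measurable X]setTI; exact: measurable_segment_val.
- by apply: density_gt0 => //; exact: ltW.
- by apply: density_gt0 => //; rewrite /w; lra.
move=> t; rewrite /excessB /excessS utilBE utilSE indicE.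
set VB := Num.max 0 (_ - Num.max _ aB); set VS := Num.max 0 (- _ - _).
have VB0 : 0 <= VB by rewrite le_max lexx.
have VS0 : 0 <= VS by rewrite le_max lexx.
have [eff1 eff0] := f_efficient t.
have /andP[? ?] := segment_val_bounds t.1.
have /andP[? ?] := segment_val_bounds t.2.
have [tE|_] := boolP (t \in _).
  move: tE; rewrite inE /= !in_itv /= => -[/andP[zt _] /andP[_ tw]].
  rewrite eff1; last by move: tw; rewrite /w; lra.
  suff : segment_val t.1 - segment_val t.2 + e <= VB + VS by rewrite mul1r; lra.
  by apply: rents_exceed_surplus; rewrite /e; move: tw; rewrite /w; lra.
rewrite mul0r.
(* Off the rectangle the rents cover the surplus, by the case e = 0 when trade is efficient. On the
   diagonal q is arbitrary, but the surplus is zero. *)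
have [lt|lt|->] := ltgtP (segment_val t.2) (segment_val t.1); last by lra.
- suff : segment_val t.1 - segment_val t.2 + 0 <= VB + VS.
    by rewrite eff1 //; lra.
  by apply: rents_exceed_surplus; lra.
- by rewrite eff0 //; lra.
Qed.

End bilateral_trade.

(** * From solution consistency to incentive compatibility *)

(** Integrals of measurable functions see a measure only through measurable sets, and a Dirac mass
    integrates by evaluation. *)
Lemma eq_dirac_integral d (A : measurableType d) (R : realType)
    (m : {measure set A -> \bar R}) (a : A) (g : A -> R) :
  (forall U, measurable U -> m U = dirac a U) ->
  measurable_fun setT g ->
  m.-integrable setT (EFin \o g) /\ (\int[m]_y (g y)%:E = (g a)%:E)%E.
Proof.
move=> ma mg.
have mEg : measurable_fun setT (EFin \o g) by exact/measurable_EFinP.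
have int (h : A -> \bar R) : measurable_fun setT h -> (\int[m]_y h y = h a)%E.
  move=> mh; rewrite (eq_measure_integral (dirac a)) => [|U mU _].
    by rewrite integral_dirac // diracT mul1e.
  exact: ma.
split; last exact: (int _ mEg).
apply/integrableP; split=> //.
by rewrite int ?ltry //; exact: measurableT_comp.
Qed.

Lemma induced_dirac {R : realType} {dB dS dA : measure_display}
    {TB : measurableType dB} {TS : measurableType dS} {A : measurableType dA}
    (gamma : mechanism A) (sigma : strategy_profile TB TS gamma)
    (f : TB * TS -> A) :
  (fun t => lottery (Defs.induced sigma t)) =
    (fun t => lottery (dirac (f t))) ->
  forall t (U : set A), measurable U ->
    Defs.induced sigma t U = dirac (f t) U :> \bar R.
Proof. by move=> + t U mU => /(congr1 (fun l => l t (exist _ U mU))). Qed.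

Theorem corollary1 (R : realType) (aB bB aS bS : R)
    (aBbB : aB <= bB) (aSbS : aS <= bS)
    (pB : probability (segment aBbB) R) (pS : probability (segment aSbS) R)
    (pB_density : has_continuous_positive_density pB)
    (pS_density : has_continuous_positive_density pS)
    (overlap : (`]aS, bS[ : set R) `&` `]aB, bB[ !=set0)
    (f : segment aBbB * segment aSbS -> alternative R)
    (f_measurable : measurable_fun setT f)
    (f_ir : individually_rational f)
    (f_efficient : ex_post_efficient f)
    (S : solution_concept (R := R)
           (segment aBbB) (segment aSbS) (alternative R)) :
  WSC utilB utilS (fun=> pS) (fun=> pB) S ->
  ~ fully_implementable S f.
Proof.
move=> wsc [gamma [outcomes _]].
have sol_f sigma : solutions S gamma sigma ->
    forall t U, measurable U ->
      Defs.induced sigma t U = dirac (f t) U :> \bar R.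
  move=> sol; apply: induced_dirac.
  have : [set (fun t => lottery (dirac (f t)))]
    ((fun t => lottery (Defs.induced sigma t)) : _ -> _ -> \bar R).
    by rewrite -outcomes; exists sigma.
  by [].
(* Read in the other direction, the equality of outcome sets yields a solution, so that WSC applies
   to [gamma]. *)
have [sigma0 sol0 _] : [set (fun t => lottery (Defs.induced sigma t)) |
    sigma in solutions S gamma] (fun t => lottery (dirac (f t))).
  by rewrite outcomes.
have euB sigma t t' (sol : solutions S gamma sigma) :
    expected_utility utilB (Defs.induced sigma t') t = (utilB (f t') t)%:E.
  by have [] := eq_dirac_integral _ _ _ _ _ _ (sol_f _ sol t')
    (measurable_utilB t).
have euS sigma t t' (sol : solutions S gamma sigma) :
    expected_utility utilS (Defs.induced sigma t') t = (utilS (f t') t)%:E.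
  by have [] := eq_dirac_integral _ _ _ _ _ _ (sol_f _ sol t')
    (measurable_utilS t).
have iB := @integrable_utilB _ _ _ _ _ _ _ pS f f_measurable f_ir.
have iS := @integrable_utilS _ _ _ _ _ _ _ pB f f_measurable f_ir.
have wd sigma : solutions S gamma sigma ->
    utilities_well_defined utilB utilS (fun=> pS) (fun=> pB) sigma.
  move=> sol; split.
  - move=> tB tB' tS.
    by have [] := eq_dirac_integral _ _ _ _ _ _ (sol_f _ sol (tB', tS))
      (measurable_utilB (tB, tS)).
  - by move=> tB tB'; under eq_fun do rewrite euB //; exact: iB.
  - move=> tS tS' tB.
    by have [] := eq_dirac_integral _ _ _ _ _ _ (sol_f _ sol (tB, tS'))
      (measurable_utilS (tB, tS)).
  - by move=> tS tS'; under eq_fun do rewrite euS //; exact: iS.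
have [icB icS] := wsc gamma (ex_intro _ _ sol0) wd.
have fineI d (Y : measurableType d) (p : probability Y R) (g : Y -> R) :
    p.-integrable setT (EFin \o g) ->
    (\int[p]_y (g y)%:E = (\int[p]_y g y)%:E)%E.
  by move=> ig; rewrite /Rintegral fineK //; exact: integrable_fin_num.
apply: (@no_incentive_compatible_efficient_trade _ _ _ _ _ _ _ pB pS f) => //.
(* The solution supplied by WSC may vary with the type, but every solution induces f, so all these
   inequalities are incentive constraints on f itself. *)
- move=> tB tB'; have [sigma sol /(_ tB')] := icB tB; rewrite /interimB.
  under eq_integral do rewrite euB //.
  under [leRHS]eq_integral do rewrite euB //.
  by rewrite !fineI // lee_fin.
- move=> tS tS'; have [sigma sol /(_ tS')] := icS tS; rewrite /interimS.
  under eq_integral do rewrite euS //.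
  under [leRHS]eq_integral do rewrite euS //.
  by rewrite !fineI // lee_fin.
Qed.
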